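(* There exists a weakly continuous square-integrable peacock $(\mu_t)_{t\ge0}$ on $\mathbb{R}^4$ such that, for the peacock $(\mu_t*\gamma^t)_{t\ge0}$, there exists no mimicking Markov martingale; that is, there is no Markov martingale $(Y_t)_{t\ge0}$ with $\mathrm{Law}(Y_t)=\mu_t*\gamma^t$ for all $t\ge0$.
   Context: A peacock is a family of probability measures $(\mu_t)$ increasing in convex order: $\int f\,\mathrm{d}\mu_s\le\int f\,\mathrm{d}\mu_t$ for every convex $f$ and $s\le t$. It is square-integrable if each $\mu_t$ has finite second moment, and weakly continuous if $t\mapsto\int f\,\mathrm{d}\mu_t$ is continuous for every bounded continuous $f$. $\gamma^t$ is the centered Gaussian law on $\mathbb{R}^4$ with covariance $t\,\mathrm{id}$, with $\gamma^0=\delta_0$; $*$ is convolution of measures. The Markov property of a process $Y$ is understood with respect to its natural filtration $\mathcal{F}^Y$ enlarged to satisfy the usual conditions of right-continuity and completeness (so in particular at time $0$ it is with respect to $\mathcal{F}^Y_0=\bigcap_{s>0}\mathcal{F}^Y_s$, completed), and $\sigma(U)$ denotes the completed sigma-algebra generated by $U$. *)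

(* Defs.v *)
From HB Require Import structures.
From mathcomp Require Import all_boot all_order all_algebra.
From mathcomp Require Import all_classical all_reals all_analysis.

Set Implicit Arguments.
Unset Strict Implicit.
Unset Printing Implicit Defensive.

Import Order.TTheory GRing.Theory Num.Theory.
Import numFieldNormedType.Exports.

Local Open Scope classical_set_scope.
Local Open Scope ring_scope.

(* The Borel sigma-algebra on matrices, hence on the row vectors 'rV[R]_n. *)
HB.instance Definition _ (R : realType) (m n : nat) :=
  @isMeasurable.Build (sigma_display (@open 'M[R]_(m, n))) 'M[R]_(m, n)
    <<s (@open 'M[R]_(m, n)) >> (@sigma_algebra0 _ setT _)
    (@sigma_algebraC _ _) (@sigma_algebra_bigcup _ setT _).

(* Families of measures and processes are indexed by all of R, but only their
   values at times t >= 0 are constrained. *)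
Section peacocks.
Context (R : realType) (n : nat).
Implicit Types mu : R -> probability 'rV[R]_n R.

(* The integrals are extended-real valued. When mu s has a finite first moment
   the negative part of a convex f is mu s-integrable, so that no +oo - oo
   occurs and the integral is the usual one, possibly +oo. *)
Definition peacock mu := forall s t : R, 0 <= s <= t ->
  forall f : 'rV[R]_n -> R,
    convex_function [set: convex_lmodType 'rV[R]_n] f ->
    (\int[mu s]_x (f x)%:E <= \int[mu t]_x (f x)%:E)%E.

Definition square_integrable mu := forall t : R, 0 <= t ->
  (\int[mu t]_x (\sum_(i < n) x ord0 i ^+ 2)%:E < +oo)%E.

Definition weakly_continuous mu := forall f : 'rV[R]_n -> R,
  continuous f -> (exists M : R, forall x, `|f x| <= M) ->
  {within `[0, +oo[%classic, continuous (fun t : R => \int[mu t]_x f x)}.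

Definition convolution (mu nu : set 'rV[R]_n -> \bar R) :
    set 'rV[R]_n -> \bar R :=
  pushforward (mu \x nu)%E (fun xy : 'rV[R]_n * 'rV[R]_n => xy.1 + xy.2).

End peacocks.

(* The second parameter of normal_prob is the standard deviation; the library
   gives normal_prob 0 0 a junk value, whence the case distinction. *)
Definition gaussian4 (R : realType) (t : R) : set 'rV[R]_4 -> \bar R :=
  if 0 < t then
    let N := normal_prob 0 (Num.sqrt t) in
    pushforward (N \x N \x N \x N)%E
      (fun z => \row_i [:: z.1.1.1; z.1.1.2; z.1.2; z.2]`_i)
  else \d_(0 : 'rV[R]_4).

Section processes.
Context d (T : measurableType d) (R : realType) (P : probability T R) (n : nat).
Implicit Types (G : set_system T) (F : R -> set_system T).
Implicit Types (X Z : T -> R) (Y : R -> T -> 'rV[R]_n).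

(* Only measurable null sets are added, so that the result is still contained
   in the sigma-algebra of T; if P is complete these are all the null sets. *)
Definition sigma_completed G : set_system T :=
  <<s G `|` [set N | measurable N /\ P N = 0%E] >>.

Definition natural_filtration Y (t : R) : set_system T :=
  <<s \bigcup_(r in `[0, t]) g_sigma_algebra_preimage (Y r) >>.

Definition usual_filtration Y (t : R) : set_system T :=
  \bigcap_(u in `]t, +oo[) sigma_completed (natural_filtration Y u).

(* Z is a version of the conditional expectation E[X | G]. *)
Definition is_cond_exp G X Z :=
  [/\ P.-integrable setT (EFin \o X),
      P.-integrable setT (EFin \o Z),
      g_sigma_algebra_preimage Z `<=` G &
      forall A, G A -> (\int[P]_(w in A) (Z w)%:E = \int[P]_(w in A) (X w)%:E)%E].

Definition is_martingale F Y :=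
  [/\ forall t : R, 0 <= t -> g_sigma_algebra_preimage (Y t) `<=` F t,
      forall (t : R) (i : 'I_n), 0 <= t ->
        P.-integrable setT (fun w => (Y t w ord0 i)%:E) &
      forall (s t : R) (i : 'I_n), 0 <= s <= t ->
        is_cond_exp (F s) (fun w => Y t w ord0 i) (fun w => Y s w ord0 i)].

(* E[f(Y_t) | F_s] = E[f(Y_t) | sigma(Y_s)] almost surely: the two conditional
   expectations have a common version. *)
Definition is_markov F Y := forall s t : R, 0 <= s <= t ->
  forall f : 'rV[R]_n -> R,
    measurable_fun setT f -> (exists M : R, forall x, `|f x| <= M) ->
    exists Z, is_cond_exp (F s) (f \o Y t) Z /\
      is_cond_exp (sigma_completed (g_sigma_algebra_preimage (Y s)))
        (f \o Y t) Z.

End processes.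

(* Main.v *)
(* mu_t is the uniform law on the five points 0 and (+-a(t), +-b(t), 0, 0), where a and b are
   continuous, nondecreasing, vanish at 0, are of order t^(1/4), and grow alternately: on
   every [16^-(k+1), 16^-k] one of them is constant.  Call a point central if it is near 0 on
   the scale of a and b.  Since t^(1/4) is much larger than the standard deviation t^(1/2) of
   the added Gaussian, for small t either of the first two coordinates alone tells whether
   Y_t is central, up to an error of order t^(1/4).  While a is constant, the first
   coordinate of a mimicking martingale has almost the same law at both ends, which are
   concentrated around 0 and +-a, so that the martingale property prevents it from moving
   from the neighbourhood of +-a to that of 0; likewise for the second coordinate while b is
   constant.  The errors are summable over k, so "Y is eventually central as t decreases to
   0" is an event of the germ field F_0 which is almost determined by Y_t being central, for
   small t.  But Y_0 = 0, so the Markov property at time 0 makes F_0 independent of Y_t,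
   while being central has probability close to 1/5. *)
From HB Require Import structures.
Require Import Defs.
From mathcomp Require Import all_boot all_order all_algebra.
From mathcomp Require Import ring lra.
From mathcomp Require Import all_classical all_reals all_analysis.
From mathcomp Require Import measurable_realfun.

Import Order.TTheory GRing.Theory Num.Theory.
Import numFieldNormedType.Exports.

Local Open Scope classical_set_scope.
Local Open Scope ring_scope.

(** * Integrals of nonnegative functions and the uniform law on five points *)

(** The integral of a nonnegative function, measurable or not, is the supremum of the integrals of
    the simple functions below it, a family that grows with the function. *)
Lemma ge0_le_integral_any {d} {T : measurableType d} {R : realType}
    (m : {measure set T -> \bar R}) (f g : T -> \bar R) :
  (forall x, 0 <= f x)%E -> (forall x, f x <= g x)%E ->
  (\int[m]_x f x <= \int[m]_x g x)%E.
Proof.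
move=> f0 fg; rewrite !ge0_integralTE//; last by move=> x; exact: le_trans (f0 x) (fg x).
by apply: le_ereal_sup => _ [h /= hf <-]; exists h => // x; exact: le_trans (hf x) (fg x).
Qed.

Definition average5 {d} {T : measurableType d} {R : realType}
    (nu : nat -> {measure set T -> \bar R}) : set T -> \bar R :=
  mscale (5^-1)%:nng%R (msum nu 5).

HB.instance Definition _ d (T : measurableType d) (R : realType)
    (nu : nat -> {measure set T -> \bar R}) :=
  Measure.on (average5 nu).

Lemma average5E {d} {T : measurableType d} {R : realType}
    (nu : nat -> {measure set T -> \bar R}) A :
  average5 nu A = ((5^-1)%:E * \sum_(i < 5) nu i A)%E.
Proof. by []. Qed.

Lemma ge0_integral_average5 {d} {T : measurableType d} {R : realType}
    (nu : nat -> {measure set T -> \bar R}) (f : T -> \bar R) :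
  measurable_fun [set: T] f -> (forall x, 0 <= f x)%E ->
  (\int[average5 nu]_x f x = (5^-1)%:E * \sum_(i < 5) \int[nu i]_x f x)%E.
Proof.
move=> mf f0; rewrite ge0_integral_mscale//.
by rewrite ge0_integral_measure_sum.
Qed.

Section atoms.
Import HBNNSimple.
Context {d} {T : measurableType d} {R : realType}.
Context (measurable_point : forall x : T, measurable [set x]).
Context (p : nat -> T).

Definition atoms : set T -> \bar R := average5 (fun i => \d_(p i)).

HB.instance Definition _ := Measure.on atoms.

Let atoms_setT : atoms setT = 1%E.
Proof.
rewrite /atoms average5E (eq_bigr (fun=> 1%E)); last by move=> i _; rewrite /= diracT.
by rewrite sumEFin -EFinM sumr_const card_ord/= mulVf.
Qed.

HB.instance Definition _ := Measure_isProbability.Build _ _ _ atoms atoms_setT.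

(* No measurability of [f] is required: a function is measurable once cut off
   outside of the finitely many atoms. *)
Lemma ge0_integral_atoms (f : T -> \bar R) : (forall x, 0 <= f x)%E ->
  (\int[atoms]_x f x = (5^-1)%:E * \sum_(i < 5) f (p i))%E.
Proof.
move=> f0; pose S := [set p (val i) | i in [set: 'I_5]].
have fS : finite_set S by apply: finite_image; exact: finite_finset.
have mfin A : A `<=` S -> measurable A.
  move=> AS; apply: countable_measurable => //.
  by apply: finite_set_countable; exact: sub_finite_set AS fS.
pose g := (f \_ S).
have g0 x : (0 <= g x)%E by rewrite /g patchE; case: ifP.
have mg : measurable_fun [set: T] g.
  apply/(measurable_restrictT f); first exact: mfin.
  move=> _ Y mY; apply: mfin; exact: subIsetl.
have gp (i : 'I_5) : g (p i) = f (p i) by rewrite /g patchE mem_set//; exists i.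
(* Upper bound through the measurable simple functions below [f], lower bound through the cut-off
   [g]. *)
apply/eqP; rewrite eq_le; apply/andP; split.
  rewrite ge0_integralTE//; apply: ge_ereal_sup => _ [h /= hf <-].
  rewrite -integralT_nnsfun ge0_integral_average5//; last 2 first.
  - exact/measurable_EFinP/measurable_funP.
  - by move=> x; rewrite lee_fin.
  apply: lee_wpmul2l => //; apply: lee_sum => i _.
  rewrite integral_dirac//; last exact/measurable_EFinP/measurable_funP.
  by rewrite diracT mul1e.
apply: (@le_trans _ _ (\int[atoms]_x g x)%E); last first.
  by apply: ge0_le_integral_any => // x; rewrite /g patchE; case: ifP.
rewrite ge0_integral_average5//; apply: lee_wpmul2l => //; apply: lee_sum => i _.
by rewrite integral_dirac// diracT mul1e gp.
Qed.

Lemma integral_atoms (f : T -> R) :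
  (\int[atoms]_x (f x)%:E = (5^-1 * \sum_(i < 5) f (p i))%:E)%E.
Proof.
rewrite integralE !ge0_integral_atoms//=.
under eq_bigr do rewrite funeposE -EFin_max.
under [X in (_ - _ * X)%E]eq_bigr do rewrite funenegE -EFinN -EFin_max.
rewrite !sumEFin -!EFinM -EFinB; congr EFin.
rewrite -mulrBr -sumrB; congr (_ * _); apply: eq_bigr => i _.
by case: (leP (f (p i)) 0) => h; case: (leP (- f (p i)) 0) => h'; lra.
Qed.

End atoms.

(** * Densities and the first absolute moment of the normal law *)

Section density.
Import HBNNSimple.

(** It suffices to treat the simple functions [h] below [f]; their integral splits over the level
    sets of [h], where the density formula applies. *)
Lemma ge0_integral_density_le {d} {T : measurableType d} {R : realType}
    (m nu : {measure set T -> \bar R}) (g : T -> R) (f : T -> \bar R) :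
  measurable_fun [set: T] g -> (forall x, 0 <= g x) ->
  (forall A, measurable A -> nu A = \int[m]_(x in A) (g x)%:E)%E ->
  (forall x, 0 <= f x)%E ->
  (\int[nu]_x f x <= \int[m]_x (f x * (g x)%:E))%E.
Proof.
move=> mg g0 nuE f0; rewrite ge0_integralTE//; apply: ge_ereal_sup => _ [h /= hf <-].
apply: (@le_trans _ _ (\int[m]_x ((h x)%:E * (g x)%:E))%E); last first.
  rewrite !ge0_integralTE//; last 2 first.
  - by move=> x; rewrite mule_ge0// lee_fin.
  - by move=> x; rewrite mule_ge0// lee_fin.
  apply: le_ereal_sup => _ [k /= kh <-]; exists k => // x.
  by apply: le_trans (kh x) _; apply: lee_wpmul2r; rewrite ?lee_fin.
pose F y x := ((y * \1_(h @^-1` [set y]) x)%:E * (g x)%:E)%E.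
have F0 y x : (0 <= F y x)%E by rewrite mule_ge0 ?lee_fin ?g0// -lee_fin nnfun_muleindic_ge0.
have mF y : measurable_fun [set: T] (F y).
  apply/measurable_EFinP; apply: measurable_funM => //; exact: measurable_funM.
have -> : (\int[m]_x ((h x)%:E * (g x)%:E) = \sum_(y \in range h) \int[m]_x F y x)%E.
  rewrite -ge0_integral_fsum//; apply: eq_integral => x _.
  rewrite /F (eq_fsbigr (fun y => (y * \1_(h @^-1` [set y]) x * g x)%:E))//.
  by rewrite fsumEFin// -EFinM [in LHS]fimfunE !fsbig_finite//= big_distrl.
rewrite sintegralE [leLHS](eq_fsbigr (fun y => \int[m]_x F y x)%E)// => y /set_mem [x0 _ <-].
rewrite nuE// integral_mkcond -ge0_integralZl_EFin//.
- apply: eq_integral => x _; rewrite patchE /F indicE.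
  by case: ifP; rewrite ?mulr1 ?mulr0 ?mul0e ?mule0.
- by move=> x _; rewrite patchE; case: ifP; rewrite ?lee_fin.
- by apply/(measurable_restrictT _ _).1 => //; apply/measurable_EFinP/measurable_funTS.
Qed.
End density.

(* The constant comes from z <= 1 + 3/8 z^2 <= exp (3/8 z^2), which bounds |y| times the
   density of N(0, s^2) by 2 s times the density of N(0, 4 s^2). *)
Lemma normal_abs_moment {R : realType} (s : R) : 0 < s ->
  (\int[normal_prob 0 s]_y `|y|%:E <= (2 * s)%:E)%E.
Proof.
move=> s0.
have s20 : 2 * s != 0 by rewrite gt_eqF// mulr_gt0.
have /le_trans -> // := ge0_integral_density_le lebesgue_measure (normal_prob 0 s)
  (normal_pdf 0 s) (fun y => `|y|%:E) (measurable_normal_pdf 0 s)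
  (normal_pdf_ge0 0 s) (fun _ _ => erefl) (fun y => normr_ge0 y).
rewrite -[leRHS]mule1 -(integral_normal_pdf 0 (2 * s)).
rewrite -ge0_integralZl_EFin//=; last 3 first.
- by move=> x _; rewrite lee_fin normal_pdf_ge0.
- by apply/measurable_EFinP; exact: measurable_normal_pdf.
- by rewrite mulr_ge0// ltW.
apply: ge0_le_integral => //=.
- by move=> x _; rewrite mule_ge0// lee_fin normal_pdf_ge0.
- apply/measurable_EFinP; apply: measurable_funM; [|exact: measurable_normal_pdf].
  exact: normr_measurable.
- apply/measurable_EFinP; apply: measurable_funM => //; exact: measurable_normal_pdf.
move=> y _; rewrite lee_fin !normal_pdfE ?(gt_eqF s0)// /normal_peak /normal_fun.
have -> : Num.sqrt ((2 * s) ^+ 2 * pi *+ 2) = 2 * Num.sqrt (s ^+ 2 * pi *+ 2).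
  rewrite (_ : (2 * s) ^+ 2 * pi *+ 2 = 2 ^+ 2 * (s ^+ 2 * pi *+ 2)); last by ring.
  by rewrite sqrtrM ?sqr_ge0// sqrtr_sqr ger0_norm.
set c := Num.sqrt _; have c0 : 0 < c.
  by rewrite sqrtr_gt0 mulrn_wgt0// !mulr_gt0// ?pi_gt0.
rewrite subr0.
set z := y / s.
have -> : - y ^+ 2 / (s ^+ 2 *+ 2) = - (3 / 8 * z ^+ 2) + - (z ^+ 2 / 8).
  by rewrite /z; field; rewrite gt_eqF.
have -> : - y ^+ 2 / ((2 * s) ^+ 2 *+ 2) = - (z ^+ 2 / 8).
  by rewrite /z; field; rewrite gt_eqF.
rewrite expRD.
have -> : 2 * s * ((2 * c)^-1 * expR (- (z ^+ 2 / 8))) =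
  s * (c^-1 * (1 * expR (- (z ^+ 2 / 8)))) by field; rewrite gt_eqF.
have -> : `|y| = s * `|z| by rewrite /z normrM normfV (gtr0_norm s0); field; rewrite gt_eqF.
set A := expR (- (3 / 8 * z ^+ 2)); set B := expR _.
suff zA : `|z| * A <= 1.
  have k0 : 0 <= s * c^-1 * B by rewrite !mulr_ge0 ?invr_ge0 ?expR_ge0// ltW.
  have := ler_wpM2l k0 zA.
  by rewrite mulr1; congr (_ <= _); ring.
rewrite /A expRN ler_pdivrMr ?expR_gt0// mul1r.
apply: le_trans (expR_ge1Dx _).
(* Expanding the square of |z| - 4/3 gives |z| <= 2/3 + 3/8 z^2. *)
rewrite -(real_normK (num_real z)); have := sqr_ge0 (`|z| - 4 / 3); nra.
Qed.

(** * Coordinates, normal tails and the marginals of the Gaussian *)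

Lemma rV_open_measurable {R : realType} {n} (A : set 'rV[R]_n) : open A -> measurable A.
Proof. by move=> oA; exact: sub_sigma_algebra. Qed.

Lemma rV_measurable_set1 {R : realType} {n} (x : 'rV[R]_n.+1) : measurable [set x].
Proof.
rewrite -[X in measurable X]setCK; apply: measurableC; apply: rV_open_measurable.
by rewrite openC; apply/accessible_closed_set1/hausdorff_accessible/norm_hausdorff.
Qed.

Definition coord {R : realType} {n} (j : 'I_n) (y : 'rV[R]_n) : R := y ord0 j.

Lemma measurable_coord {R : realType} {n} (j : 'I_n) :
  measurable_fun [set: 'rV[R]_n] (coord j).
Proof.
apply: (measurability _ (RGenOpens.measurableE R)) => _ [_ [a [b ->]] <-].
rewrite setTI; apply: rV_open_measurable.
apply: open_comp; last exact: itv_open.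
by move=> y _; exact: coord_continuous.
Qed.

HB.instance Definition _ (R : realType) n (j : 'I_n) :=
  isMeasurableFun.Build _ _ _ _ (@coord R n j) (@measurable_coord R n j).

Lemma measurable_shift {R : realType} (a : R) : measurable_fun [set: R] (+%R a).
Proof. by apply: measurable_funD. Qed.

(** Markov's inequality for the first absolute moment. *)
Lemma normal_tail {R : realType} (s h : R) : 0 < s -> 0 < h ->
  (normal_prob 0 s [set y : R | (h <= `|y|)%R] <= (2 * s / h)%:E)%E.
Proof.
move=> s0 h0.
rewrite [_ / _]mulrC EFinM lee_pdivlMl// -[Y in (_ * normal_prob _ _ Y <= _)%E]setTI.
apply: le_trans (normal_abs_moment _ s0).
have := @le_integral_comp_abse _ _ _ (normal_prob 0 s) _ measurableT (@EFin R) h id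
  (@measurable_id _ _ _) (fun r h => h).
apply => //.
Qed.

(** The two axes that carry the construction are indexed by booleans, so that [odd k] selects one of
    them and negation the other. *)
Definition axis (c : bool) : 'I_4 := if c then 1 else 0.

Definition gauss4_map {R : realType} (z : R * R * R * R) : 'rV[R]_4 :=
  \row_i [:: z.1.1.1; z.1.1.2; z.1.2; z.2]`_i.

Lemma gauss4_map_axis {R : realType} c (z : R * R * R * R) :
  gauss4_map z ord0 (axis c) = if c then z.1.1.2 else z.1.1.1.
Proof. by rewrite mxE; case: c. Qed.

Lemma measurable_gauss4_axis {R : realType} c :
  measurable_fun [set: R * R * R * R] (fun z => gauss4_map z ord0 (axis c)).
Proof.
under eq_fun do rewrite gauss4_map_axis.
case: c.
  exact: (measurableT_comp measurable_snd (measurableT_comp measurable_fst measurable_fst)).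
exact: (measurableT_comp measurable_fst (measurableT_comp measurable_fst measurable_fst)).
Qed.

Lemma gaussian4_ge0 {R : realType} (t : R) A : (0 <= gaussian4 t A)%E.
Proof.
rewrite /gaussian4; case: ifP => // _.
by rewrite /pushforward; apply: integral_ge0.
Qed.

(** The preimage under [gauss4_map] is a box all of whose sides but one are the whole line, of mass
    1. *)
Lemma gaussian4_axis {R : realType} (t : R) c (S : set R) : 0 < t -> measurable S ->
  gaussian4 t [set y | S (y ord0 (axis c))] = normal_prob 0 (Num.sqrt t) S.
Proof.
move=> t0 mS; rewrite /gaussian4 t0 /pushforward.
have NT : normal_prob 0 (Num.sqrt t) [set: R] = 1%E by exact: probability_setT.
have -> : (fun z : R * R * R * R => \row_i [:: z.1.1.1; z.1.1.2; z.1.2; z.2]`_i)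
   @^-1` [set y : 'rV[R]_4 | S (y ord0 (axis c))] =
   ((if c then setT else S) `*` (if c then S else setT)) `*` setT `*` setT.
  rewrite -/gauss4_map; apply/seteqP; split => z; rewrite /= gauss4_map_axis.
    by case: c.
  by case: c => -[[[]]].
rewrite [LHS]product_measure1E//; last first.
  by apply: measurableX => //; apply: measurableX; case: c.
rewrite [X in (X * _)%E]product_measure1E//; last by apply: measurableX; case: c.
rewrite [X in (X * _ * _)%E]product_measure1E; [|by case: c|by case: c].
by case: c => /=; rewrite !NT ?mule1 ?mul1e.
Qed.

(** * Cross laws and their convolution with the Gaussian *)

(* The vertices are numbered from 1; number 0 is the centre of the cross. *)
Definition vertex (c : bool) (i : nat) : int :=
  (if c then [:: 0; 1; -1; 1; -1] else [:: 0; 1; 1; -1; -1])`_i.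

(** The centre and the four corners of a rectangle with half-sides [s false] and [s true]: when
    these are positive, either coordinate alone tells the centre from the corners. *)
Definition cross {R : realType} (s : bool -> R) (i : nat) : 'rV[R]_4 :=
  \row_j (if (j < 2)%N then (vertex (j == 1) i)%:~R * s (j == 1) else 0).

Lemma cross_axis {R : realType} (s : bool -> R) i c :
  cross s i ord0 (axis c) = (vertex c i)%:~R * s c.
Proof. by rewrite mxE; case: c. Qed.

Lemma vertex0 {R : realType} c : (vertex c 0)%:~R = 0 :> R.
Proof. by case: c. Qed.

Lemma vertexS {R : realType} c (i : 'I_4) : `|(vertex c (lift ord0 i))%:~R| = 1 :> R.
Proof. by case: c; case: i => -[|[|[|[|//]]]] i; rewrite /= ?normrN ?normr1. Qed.

Definition cross_law {R : realType} (s : bool -> R) : probability 'rV[R]_4 R :=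
  atoms (cross s).

(** Integration over the atoms is a finite sum for every nonnegative function, so [B] ranges over
    all sets. *)
Lemma convolution_cross {R : realType} (s : bool -> R) (t : R) (B : set 'rV[R]_4) :
  (convolution (cross_law s) (gaussian4 t) B =
    (5^-1)%:E * \sum_(i < 5) gaussian4 t [set y | B (cross s i + y)%R])%E.
Proof.
rewrite /convolution /pushforward /product_measure1 ge0_integral_atoms; last 2 first.
- exact: rV_measurable_set1.
- by move=> x; exact: gaussian4_ge0.
congr (_ * _)%E; apply: eq_bigr => i _; congr gaussian4.
by apply/seteqP; split => y; rewrite /xsection/= ?inE//= => h; rewrite inE.
Qed.

Lemma measurable_shiftR {R : realType} (a : R) :
  measurable_fun [set: measurableTypeR R] (+%R a : measurableTypeR R -> R).
Proof. exact: measurable_shift. Qed.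

(** The normal law centred at [a], encoded as a translate so that integrals against it reduce to the
    centred law. *)
Definition normal_at {R : realType} (s a : R) : {measure set R -> \bar R} :=
  measure_function_pushforward__canonical__measure_function_Measure
    (normal_prob 0 s) (measurable_shiftR a).

Lemma ge0_integral_normal_at {R : realType} (s a : R) (f : R -> \bar R) :
  measurable_fun [set: R] f -> (forall x, 0 <= f x)%E ->
  (\int[normal_at s a]_x f x = \int[normal_prob 0 s]_y f (a + y)%R)%E.
Proof.
by move=> mf f0; rewrite (ge0_integral_pushforward (measurable_shiftR a)).
Qed.

Section law_on_an_axis.
Context {R : realType} {d} {T : measurableType d} (P : probability T R).
Context (Y : {RV P >-> 'rV[R]_4}) (s : bool -> R) (t : R).
Context (t0 : 0 < t).
Context (lawY : forall B : set 'rV[R]_4, measurable B ->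
  distribution P Y B = convolution (cross_law s) (gaussian4 t) B).

Let N := normal_prob 0 (Num.sqrt t).

Lemma measurable_axis c (S : set R) : measurable S ->
  measurable [set y : 'rV[R]_4 | S (y ord0 (axis c))].
Proof.
by move=> mS; rewrite -[X in measurable X]setTI; exact: measurable_coord.
Qed.

Lemma law_axis c (S : set R) : measurable S ->
  P [set w | S (Y w ord0 (axis c))] =
  average5 (fun i => normal_at (Num.sqrt t) ((vertex c i)%:~R * s c)) S.
Proof.
move=> mS; have := lawY _ (measurable_axis c _ mS).
rewrite convolution_cross /distribution /pushforward /preimage /= => ->.
rewrite average5E; congr (_ * _)%E; apply: eq_bigr => i _.
rewrite /normal_at/= /pushforward -(gaussian4_axis _ c)//; last first.
  by rewrite -[X in measurable X]setTI; exact: measurable_shift.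
by congr gaussian4; apply/seteqP; split => y; rewrite /= mxE cross_axis.
Qed.

Lemma ge0_expectation_axis c (f : R -> \bar R) : measurable_fun [set: R] f ->
  (forall x, 0 <= f x)%E ->
  (\int[P]_w f (Y w ord0 (axis c)) =
    (5^-1)%:E * \sum_(i < 5) \int[N]_y f ((vertex c i)%:~R * s c + y)%R)%E.
Proof.
move=> mf f0.
have -> : (\int[P]_w f (Y w ord0 (axis c)) =
    \int[pushforward P (coord (axis c) \o Y)]_x f x)%E.
  by rewrite ge0_integral_pushforward// => ? ?; exact: measurableT_comp.
rewrite (eq_measure_integral
  (average5 (fun i => normal_at (Num.sqrt t) ((vertex c i)%:~R * s c)))).
  rewrite ge0_integral_average5//; congr (_ * _)%E; apply: eq_bigr => i _.
  exact: ge0_integral_normal_at.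
by move=> S mS _; rewrite -[RHS]law_axis.
Qed.

End law_on_an_axis.

(** * Estimates at a single time *)

(** The distance from [x] to the set {-r, 0, r} of projected cross points. *)
Definition cross_dist {R : realType} (r x : R) : R :=
  Num.min `|x| (Num.min `|x - r| `|x + r|).

Lemma measurable_cross_dist {R : realType} (r : R) :
  measurable_fun [set: R] (cross_dist r).
Proof.
apply: measurable_minr; first exact: normr_measurable.
apply: measurable_minr; apply: measurableT_comp => //; first exact: measurable_funB.
exact: measurable_funD.
Qed.

Lemma cross_dist_ge0 {R : realType} (r x : R) : 0 <= cross_dist r x.
Proof. by rewrite /cross_dist !le_min !normr_ge0. Qed.

Lemma cross_dist_vertex {R : realType} (r y : R) c i :
  cross_dist r ((vertex c i)%:~R * r + y) <= `|y|.
Proof.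
rewrite /cross_dist !ge_min.
have : (vertex c i)%:~R \in [:: 0; 1; -1 : R].
  (* Beyond index 4 the default value 0 of the list access is again one of the three values. *)
  by case: c; case: i => [|[|[|[|[|i]]]]]; rewrite /vertex /= ?nth_nil ?inE ?eqxx ?orbT.
rewrite !inE => /or3P[] /eqP ->.
- by rewrite mul0r add0r lexx.
- by rewrite mul1r (_ : r + y - r = y) ?lexx ?orbT//; ring.
- by rewrite mulN1r (_ : - r + y + r = y) ?lexx ?orbT//; ring.
Qed.

(* Only the first two coordinates are used, which avoids the measurability of [gauss4_map]
   for the Borel sigma-algebra of ['rV[R]_4]. *)
Lemma gaussian4_axes_le {R : realType} (t : R) (c c1 c2 : bool) (S S1 S2 : set R) :
  0 < t -> measurable S -> measurable S1 -> measurable S2 ->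
  (forall y : bool -> R, S1 (y c1) -> S2 (y c2) -> S (y c)) ->
  (gaussian4 t [set y | S1 (y ord0 (axis c1)) /\ S2 (y ord0 (axis c2))]
    <= normal_prob 0 (Num.sqrt t) S)%E.
Proof.
move=> t0 mS mS1 mS2 sub; rewrite -(gaussian4_axis _ c)// /gaussian4 t0 /pushforward.
have mpre b (U : set R) : measurable U ->
    measurable [set z : R * R * R * R | U (gauss4_map z ord0 (axis b))].
  by move=> mU; rewrite -[X in measurable X]setTI; exact: measurable_gauss4_axis.
apply: le_measure; rewrite ?inE.
- exact: measurableI (mpre c1 _ mS1) (mpre c2 _ mS2).
- exact: mpre.
- move=> z [h1 h2]; apply: (sub (fun b => gauss4_map z ord0 (axis b)) h1 h2).
Qed.

Lemma average_le {R : realType} (F : 'I_5 -> \bar R) (e : R) :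
  (forall i, F i <= e%:E)%E -> ((5^-1)%:E * \sum_(i < 5) F i <= e%:E)%E.
Proof.
move=> Fe; apply: (@le_trans _ _ ((5^-1)%:E * \sum_(i < 5) e%:E)%E).
  by apply: lee_wpmul2l; rewrite ?lee_fin ?invr_ge0//; apply: lee_sum.
by rewrite sumEFin -EFinM sumr_const card_ord lee_fin -[e *+ 5]mulr_natl mulKf.
Qed.

Lemma cross_add_axis {R : realType} (s : bool -> R) i c (y : 'rV[R]_4) :
  (cross s i + y) ord0 (axis c) = (vertex c i)%:~R * s c + y ord0 (axis c).
Proof. by rewrite mxE cross_axis. Qed.

Section estimates.
Context {R : realType} {d} {T : measurableType d} (P : probability T R).
Context (Y : {RV P >-> 'rV[R]_4}) (s : bool -> R) (t : R).
Context (t0 : 0 < t) (s0 : forall c, 0 < s c).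
Context (lawY : forall B : set 'rV[R]_4, measurable B ->
  distribution P Y B = convolution (cross_law s) (gaussian4 t) B).

Let st0 : 0 < Num.sqrt t. Proof. by rewrite sqrtr_gt0. Qed.

(** Each component of the mixture is a point of {-r, 0, r}, with [r = s c], displaced by the noise,
    so its mean distance to that set is at most the mean size of the noise. *)
Lemma expectation_cross_dist_le c :
  (\int[P]_w (cross_dist (s c) (Y w ord0 (axis c)))%:E <= (2 * Num.sqrt t)%:E)%E.
Proof.
rewrite (ge0_expectation_axis P Y s t t0 lawY c (EFin \o cross_dist (s c)))//=; last 2 first.
- by apply/measurable_EFinP; exact: measurable_cross_dist.
- by move=> x; rewrite lee_fin cross_dist_ge0.
apply: average_le => i; apply: le_trans (normal_abs_moment _ st0).
apply: ge0_le_integral_any => y; first by rewrite lee_fin cross_dist_ge0.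
by rewrite lee_fin cross_dist_vertex.
Qed.

Let measurable_near (a h : R) : measurable [set x : R | `|a + x| < h].
Proof.
have m : measurable_fun [set: R] (fun x => `|a + x|).
  by apply: measurableT_comp => //; exact: measurable_shift.
by rewrite -[X in measurable X]setTI; exact: (@measurable_fun_ltr _ _ _ _ _ (cst h) m).
Qed.

Let measurable_center (h : R) : measurable [set x : R | `|x| < h].
Proof. by have := measurable_near 0 h; under eq_set do rewrite add0r. Qed.

Let measurable_far (a h : R) : measurable [set x : R | h <= `|a + x|].
Proof.
rewrite (_ : [set x : R | h <= `|a + x|] = ~` [set x : R | `|a + x| < h]).
  exact: measurableC.
by apply/seteqP; split => x /=; [rewrite ltNge => -> |move/negP; rewrite -leNgt].
Qed.

Let measurable_noise (h : R) : measurable [set x : R | h <= `|x|].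
Proof. by have := measurable_far 0 h; under eq_set do rewrite add0r. Qed.

Let noise_tail c :
  (normal_prob 0 (Num.sqrt t) [set y | s c / 2 <= `|y|]%R <= (4 * Num.sqrt t / s c)%:E)%E.
Proof.
have h0 : 0 < s c / 2 by rewrite divr_gt0.
apply: le_trans (normal_tail _ _ st0 h0) _; rewrite lee_fin.
by rewrite le_eqVlt; apply/orP; left; apply/eqP; field; rewrite gt_eqF.
Qed.

Let small_far_vertex c (i : 'I_4) (y : R) :
  `|(vertex c (lift ord0 i))%:~R * s c + y| < s c / 2 -> s c / 2 <= `|y|.
Proof.
have e : `|(vertex c (lift ord0 i))%:~R * s c| = s c.
  by rewrite normrM vertexS mul1r gtr0_norm.
have := lerB_normD ((vertex c (lift ord0 i))%:~R * s c) y.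
rewrite e; lra.
Qed.

(** The axes disagree only through noise of at least half an arm: along [c] if the point is a
    vertex, along [c'] if it is the centre. *)
Lemma mode_disagreement c c' :
  (P [set w | `|Y w ord0 (axis c)| < s c / 2 /\ s c' / 2 <= `|Y w ord0 (axis c')| ]%R
    <= (4 * Num.sqrt t / s c + 4 * Num.sqrt t / s c')%:E)%E.
Proof.
have mB : measurable [set y : 'rV[R]_4 | `|y ord0 (axis c)| < s c / 2 /\
                                  s c' / 2 <= `|y ord0 (axis c')| ].
  apply: measurableI.
    apply: (measurable_axis c [set x | `|x| < s c / 2]).
    exact: measurable_center.
  apply: (measurable_axis c' [set x | s c' / 2 <= `|x|]).
  exact: measurable_noise.
have := lawY _ mB; rewrite convolution_cross /distribution /pushforward /preimage /= => ->.
apply: average_le => i.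
have pos b : 0 <= 4 * Num.sqrt t / s b by rewrite !mulr_ge0// ?invr_ge0 ltW.
pose S1 := [set x | `|(vertex c i)%:~R * s c + x| < s c / 2].
pose S2 := [set x | s c' / 2 <= `|(vertex c' i)%:~R * s c' + x|].
have -> : [set y : 'rV[R]_4 | `|(cross s i + y) ord0 (axis c)| < s c / 2 /\
    s c' / 2 <= `|(cross s i + y) ord0 (axis c')| ] =
    [set y | S1 (y ord0 (axis c)) /\ S2 (y ord0 (axis c'))].
  by apply/seteqP; split => y /=; rewrite !cross_add_axis.
case: (unliftP ord0 i) => [j ij|i0].
  apply: (@le_trans _ _ (4 * Num.sqrt t / s c)%:E); last by rewrite lee_fin lerDl.
  apply: le_trans (noise_tail c).
  apply: (gaussian4_axes_le t c c c') => //; [exact: measurable_near|exact: measurable_far|].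
  by move=> y h1 _; rewrite /S1 /= ij in h1; exact: (small_far_vertex c j (y c) h1).
apply: (@le_trans _ _ (4 * Num.sqrt t / s c')%:E); last by rewrite lee_fin lerDr.
apply: le_trans (noise_tail c').
apply: (gaussian4_axes_le t c' c c') => //; [exact: measurable_near|exact: measurable_far|].
by move=> y _; rewrite /S2 /= i0 vertex0 mul0r add0r.
Qed.

Let mode_prob c : P [set w | `|Y w ord0 (axis c)| < s c / 2] =
  ((5^-1)%:E * \sum_(i < 5) normal_prob 0 (Num.sqrt t)
    [set y : R | `|(vertex c i)%:~R * s c + y| < s c / 2]%R)%E.
Proof.
exact: (law_axis P Y s t t0 lawY c [set x | `|x| < s c / 2] (measurable_center _)).
Qed.

(** The centre contributes at most 1/5, and each vertex at most a fifth of the noise tail. *)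
Lemma mode_prob_le c :
  (P [set w | `|Y w ord0 (axis c)| < s c / 2]%R <= (5^-1 + 4 * Num.sqrt t / s c)%:E)%E.
Proof.
have e0 : 0 <= 4 * Num.sqrt t / s c by rewrite !mulr_ge0// ?invr_ge0 ltW.
rewrite mode_prob big_ord_recl.
apply: (@le_trans _ _ ((5^-1)%:E * (1 + \sum_(i < 4) (4 * Num.sqrt t / s c)%:E))%E).
  apply: lee_wpmul2l; first by rewrite lee_fin.
  apply: leeD; first by apply: probability_le1; exact: measurable_near.
  apply: lee_sum => i _; apply: le_trans (noise_tail c).
  apply: le_measure; rewrite ?inE; first exact: measurable_near.
    exact: measurable_noise.
  by move=> y; exact: (small_far_vertex c i y).
rewrite sumEFin -EFinD -EFinM lee_fin sumr_const card_ord -[_ *+ 4]mulr_natl; lra.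
Qed.

(** Only the term of the centre is kept, where the complementary event is the noise tail. *)
Lemma mode_prob_ge c :
  ((5^-1 - 4 * Num.sqrt t / s c)%:E <= P [set w | `|Y w ord0 (axis c)| < s c / 2]%R)%E.
Proof.
have e0 : 0 <= 4 * Num.sqrt t / s c by rewrite !mulr_ge0// ?invr_ge0 ltW.
rewrite mode_prob big_ord_recl.
apply: (@le_trans _ _ ((5^-1)%:E * (1 - 4 * Num.sqrt t / s c)%:E)%E).
  by rewrite -EFinM lee_fin; lra.
apply: lee_wpmul2l; first by rewrite lee_fin.
apply: (@le_trans _ _ (normal_prob 0 (Num.sqrt t)
    [set y : R | `|(vertex c 0)%:~R * s c + y| < s c / 2]%R)); last first.
  by rewrite leeDl// sume_ge0.
have -> : [set y : R | `|(vertex c 0)%:~R * s c + y| < s c / 2] =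
    ~` [set y | s c / 2 <= `|y|].
  apply/seteqP; split => y /=; rewrite vertex0 mul0r add0r.
    by rewrite ltNge => /negP.
  by move/negP; rewrite -ltNge.
rewrite probability_setC; last exact: measurable_noise.
by rewrite EFinB leeB// noise_tail.
Qed.

End estimates.

(** * Persistence of the mode under the martingale property *)

(** Since [r / 2 <= x'], no point of {-r, 0, r} is closer to [x'] than [r - x']. The left side is
    below [r] if [x < r / 2]; otherwise it is [x], which exceeds [r] by at most its distance. *)
Lemma cross_dist_barrier {R : realType} (r x x' : R) : 0 < r -> r / 2 <= x' ->
  r / 2 * (x < r / 2)%R%:R + x <= x' + (cross_dist r x + cross_dist r x').
Proof.
move=> r0 rx'.
have e1 : r - x' <= cross_dist r x'.
  by rewrite /cross_dist !le_min !ler_normr; apply/and3P; split; apply/orP; lra.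
have e2 : x - r <= cross_dist r x.
  by rewrite /cross_dist !le_min !ler_normr; apply/and3P; split; apply/orP; lra.
have := cross_dist_ge0 r x; case: (ltP x (r / 2)) => /= h; lra.
Qed.

Lemma integrable_cross_dist {R : realType} {d} {T : measurableType d}
    (m : {measure set T -> \bar R}) (r : R) (X : T -> R) :
  m.-integrable [set: T] (EFin \o X) ->
  m.-integrable [set: T] (EFin \o (cross_dist r \o X)).
Proof.
move=> iX; apply: (le_integrable measurableT _ _ iX).
  apply/measurable_EFinP; apply: measurableT_comp; first exact: measurable_cross_dist.
  by apply/measurable_EFinP; exact: (measurable_int m).
move=> x _ /=; rewrite lee_fin ger0_norm ?cross_dist_ge0//.
by rewrite /cross_dist ge_min lexx.
Qed.

(* On [r / 2 <= X'] the variable X' is at least r up to its distance to {0, -r, r}, whereas X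
   exceeds r by at most its distance to that set and loses r / 2 where X < r / 2; the means
   being equal, the loss is paid by the distances. *)
Lemma barrier_crossing {R : realType} {d} {T : measurableType d} (P : probability T R)
    (X X' : T -> R) (r : R) : 0 < r ->
  P.-integrable [set: T] (EFin \o X) -> P.-integrable [set: T] (EFin \o X') ->
  (\int[P]_(w in [set w | (r / 2 <= X' w)%R]) (X' w)%:E =
   \int[P]_(w in [set w | (r / 2 <= X' w)%R]) (X w)%:E)%E ->
  ((r / 2)%:E * P [set w | (r / 2 <= X' w)%R /\ (X w < r / 2)%R] <=
    \int[P]_w (cross_dist r (X w))%:E + \int[P]_w (cross_dist r (X' w))%:E)%E.
Proof.
move=> r0 iX iX'; set A := [set w | _] => mart.
have mX : measurable_fun [set: T] X by apply/measurable_EFinP; exact: (measurable_int P).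
have mX' : measurable_fun [set: T] X' by apply/measurable_EFinP; exact: (measurable_int P).
have mA : measurable A.
  rewrite -[A]setTI; exact: (measurable_fun_ler (f := cst (r / 2)) _ mX').
have mB : measurable [set w | X w < r / 2].
  rewrite -[X in measurable X]setTI; exact: (measurable_fun_ltr (g := cst (r / 2)) mX _).
have iS f : P.-integrable [set: T] (EFin \o f) -> P.-integrable A (EFin \o f).
  by apply: integrableS.
pose I w := r / 2 * (X w < r / 2)%R%:R.
have IE : I = (fun w => r / 2 * \1_[set w | X w < r / 2] w).
  apply/funext => w; rewrite /I indicE; congr (_ * (nat_of_bool _)%:R).
  by apply/idP/idP; rewrite inE.
have iI : P.-integrable [set: T] (EFin \o I).
  rewrite IE.
  apply: (integrableZl measurableT (r / 2) (f := EFin \o \1_[set w | X w < r / 2])).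
  exact: integrable_indic.
have -> : ((r / 2)%:E * P [set w | (r / 2 <= X' w)%R /\ (X w < r / 2)%R] =
    \int[P]_(w in A) (I w)%:E)%E.
  under eq_integral do rewrite IE EFinM.
  rewrite integralZl//; last by apply: (iS \1__); exact: integrable_indic.
  rewrite integral_indic//; congr (_ * P _)%E.
  by apply/seteqP; split => w [].
have le1 : (\int[P]_(w in A) (I w)%:E + \int[P]_(w in A) (X w)%:E <=
   \int[P]_(w in A) (X' w)%:E + (\int[P]_(w in A) (cross_dist r (X w))%:E +
     \int[P]_(w in A) (cross_dist r (X' w))%:E))%E.
  have iD := integrable_cross_dist P r X iX; have iD' := integrable_cross_dist P r X' iX'.
  have iDA := iS _ iD; have iDA' := iS _ iD'.
  have iIA := iS _ iI; have iXA := iS _ iX; have iXA' := iS _ iX'.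
  have iDD : P.-integrable A (EFin \o (fun w => cross_dist r (X w) + cross_dist r (X' w))).
    exact: (integrableD mA iDA iDA').
  rewrite -!integralD_EFin//.
  apply: le_integral => //.
  - exact: (integrableD mA iIA iXA).
  - exact: (integrableD mA iXA' iDD).
  - by move=> w /set_mem Aw; rewrite lee_fin; exact: cross_dist_barrier.
(* By [mart] the integrals of [X] and [X'] over [A] agree; being finite, they cancel. *)
have fX : (\int[P]_(w in A) (X w)%:E)%E \is a fin_num.
  by apply: integrable_fin_num => //; exact: iS.
rewrite mart addeC leeD2lE// in le1.
apply: le_trans le1 _; apply: leeD; apply: ge0_subset_integral => //.
- by apply/measurable_EFinP; apply: measurableT_comp; first exact: measurable_cross_dist.
- by move=> w _; rewrite lee_fin cross_dist_ge0.
- by apply/measurable_EFinP; apply: measurableT_comp; first exact: measurable_cross_dist.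
- by move=> w _; rewrite lee_fin cross_dist_ge0.
Qed.

Lemma cross_distN {R : realType} (r x : R) : cross_dist r (- x) = cross_dist r x.
Proof.
have -> : cross_dist r (- x) = Num.min `|- x| (Num.min `|- (x + r)| `|- (x - r)|).
  by rewrite /cross_dist opprB opprD [r - x]addrC.
by rewrite !normrN [Num.min `|x + r| _]minC.
Qed.

Section mode_persistence.
Context {R : realType} {d} {T : measurableType d} (P : probability T R).
Context (F : R -> set_system T) (Y : R -> {RV P >-> 'rV[R]_4}).
Context (martY : is_martingale P F Y).
Context (u t : R) (su st : bool -> R) (c : bool).
Context (u0 : 0 < u) (ut : u <= t) (t0 : forall b, 0 < st b).
Context (suc : su c = st c).
Context (lawu : forall B : set 'rV[R]_4, measurable B ->
  distribution P (Y u) B = convolution (cross_law su) (gaussian4 u) B).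
Context (lawt : forall B : set 'rV[R]_4, measurable B ->
  distribution P (Y t) B = convolution (cross_law st) (gaussian4 t) B).

Let tpos : 0 < t. Proof. exact: lt_le_trans ut. Qed.
Let X (v : R) (w : T) : R := Y v w ord0 (axis c).

Let iX v : 0 < v -> P.-integrable [set: T] (EFin \o X v).
Proof. by move=> v0; case: martY => _ + _; apply; exact: ltW. Qed.

Let mX v : measurable_fun [set: T] (X v).
Proof. exact: (measurableT_comp (measurable_coord (axis c))). Qed.

Let X_mart (S : set R) : measurable S ->
  (\int[P]_(w in [set w | S (X u w)]) (X u w)%:E =
   \int[P]_(w in [set w | S (X u w)]) (X t w)%:E)%E.
Proof.
move=> mS; case: martY => adapted _ /(_ u t (axis c)) mart.
have [_ _ _ ->//] : is_cond_exp P (F u) (X t) (X u) by apply: mart; rewrite ltW.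
apply: (adapted u (ltW u0)); exists [set y : 'rV[R]_4 | S (y ord0 (axis c))].
  exact: measurable_axis.
by rewrite setTI.
Qed.

Let dist_bound :
  (\int[P]_w (cross_dist (st c) (X t w))%:E + \int[P]_w (cross_dist (st c) (X u w))%:E
    <= (4 * Num.sqrt t)%:E)%E.
Proof.
have et := expectation_cross_dist_le P (Y t) st t tpos lawt c.
have eu := expectation_cross_dist_le P (Y u) su u u0 lawu c.
rewrite suc in eu.
apply: le_trans (leeD et eu) _; rewrite -EFinD lee_fin.
have : Num.sqrt u <= Num.sqrt t by rewrite ler_wsqrtr.
by lra.
Qed.

Let one_side (S : set T) : ((st c / 2)%:E * P S <= (4 * Num.sqrt t)%:E)%E ->
  (P S <= (8 * Num.sqrt t / st c)%:E)%E.
Proof.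
have h0 : 0 < st c / 2 by rewrite divr_gt0.
rewrite -lee_pdivlMl// -EFinM => /le_trans; apply; rewrite lee_fin le_eqVlt.
by apply/orP; left; apply/eqP; field; rewrite gt_eqF.
Qed.

(** At time [u] the coordinate is on one of two sides of 0. The crossing estimate treats one side
    for the coordinate and the other for its negative; each contributes 8 to the constant. *)
Lemma mode_persistence :
  (P [set w | `|Y t w ord0 (axis c)| < st c / 2 /\
              st c / 2 <= `|Y u w ord0 (axis c)| ]%R
    <= (16 * Num.sqrt t / st c)%:E)%E.
Proof.
have iXt := iX _ tpos; have iXu := iX _ u0.
pose A := [set w | (st c / 2 <= X u w)%R /\ (X t w < st c / 2)%R].
pose A' := [set w | (st c / 2 <= - X u w)%R /\ (- X t w < st c / 2)%R].
have PA : (P A <= (8 * Num.sqrt t / st c)%:E)%E.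
  apply: one_side; apply: le_trans dist_bound.
  apply: barrier_crossing => //.
  by apply: (X_mart [set x | st c / 2 <= x]); rewrite -set_itvcy; exact: measurable_itv.
have PA' : (P A' <= (8 * Num.sqrt t / st c)%:E)%E.
  apply: one_side; apply: le_trans dist_bound.
  (* The distance is even, so [dist_bound] also serves for the negatives. *)
  under eq_integral do rewrite -cross_distN.
  under [X in (_ <= _ + X)%E]eq_integral do rewrite -cross_distN.
  apply: (barrier_crossing P (fun w => - X t w) (fun w => - X u w)) => //.
  - by have := integrableN iXt; apply: eq_integrable.
  - by have := integrableN iXu; apply: eq_integrable.
  set B := [set w | _].
  have mB : measurable B.
    rewrite -[B]setTI.
    by apply: (measurable_fun_ler (f := cst (st c / 2))) => //; exact: measurable_funN.
  under eq_integral do rewrite EFinN -mulN1e.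
  under [RHS]eq_integral do rewrite EFinN -mulN1e.
  rewrite !integralZl//; [|exact: (integrableS measurableT mB _ iXt)
    |exact: (integrableS measurableT mB _ iXu)].
  congr (_ * _)%E; apply: (X_mart [set x | st c / 2 <= - x]).
  rewrite (_ : [set x | _] = `]-oo, - (st c / 2)]%classic).
    exact: measurable_itv.
  by apply/seteqP; split => x; rewrite /= in_itv/= lerNr.
have mA : measurable A.
  apply: measurableI.
    rewrite -[X in measurable X]setTI.
    exact: (measurable_fun_ler (f := cst (st c / 2)) _ (mX u)).
  rewrite -[X in measurable X]setTI.
  exact: (measurable_fun_ltr (g := cst (st c / 2)) (mX t) _).
have mA' : measurable A'.
  apply: measurableI.
    rewrite -[X in measurable X]setTI; apply: (measurable_fun_ler (f := cst (st c / 2))) => //.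
    exact: measurable_funN.
  rewrite -[X in measurable X]setTI; apply: (measurable_fun_ltr (g := cst (st c / 2))) => //.
  exact: measurable_funN.
apply: (@le_trans _ _ (P (A `|` A'))).
  apply: le_measure; rewrite ?inE//.
  - apply: measurableI.
      have m : measurable_fun [set: T] (fun w => `|X t w|) by exact: measurableT_comp.
      rewrite -[X in measurable X]setTI.
      exact: (measurable_fun_ltr (g := cst (st c / 2)) m _).
    have m : measurable_fun [set: T] (fun w => `|X u w|) by exact: measurableT_comp.
    rewrite -[X in measurable X]setTI.
    exact: (measurable_fun_ler (f := cst (st c / 2)) _ m).
  - exact: measurableU.
  - move=> w /= [+]; rewrite ltr_norml ler_normr => /andP[h1 h2] /orP[h|h].
      by left; split.
    by right; split => //; rewrite ltrNl.
apply: le_trans (measureU2 _ mA mA') _.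
apply: le_trans (leeD PA PA') _; rewrite -EFinD lee_fin; lra.
Qed.

End mode_persistence.

(** * Staircase functions and the lengths of the arms *)

Definition dyadic_half_open {R : realType} (k : nat) : set R :=
  `]2^-1 ^+ k.+1, 2^-1 ^+ k]%classic.

(* [staircase true] and [staircase false] have slope 0 or 1 on every dyadic interval and
   rise in turn: [staircase b] rises on ]2^-(k+1), 2^-k] iff [odd k != b]. *)
Definition rises {R : realType} (b : bool) : set R :=
  \bigcup_(k in [set k | odd k != b]) dyadic_half_open k.

(** Defined as the measure of a set, it is visibly nondecreasing and 1-Lipschitz, with no case
    analysis on the dyadic intervals. *)
Definition staircase {R : realType} (b : bool) (x : R) : R :=
  fine (lebesgue_measure (rises b `&` `]0, x]%classic)).

Section staircase.
Context {R : realType}.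
Implicit Types (x y : R) (b : bool) (k : nat).

Let measurable_rises b : measurable (rises b : set R).
Proof. by apply: bigcup_measurable => k _; exact: measurable_itv. Qed.

Let measurable_below b x : measurable (rises b `&` `]0, x]%classic).
Proof. exact: measurableI. Qed.

Let below_fin b x : lebesgue_measure (rises b `&` `]0, x]%classic) \is a fin_num.
Proof.
rewrite ge0_fin_numE//; apply: (@le_lt_trans _ _ (lebesgue_measure `]0%R, x]%classic)).
  by apply: le_measure; rewrite ?inE//; exact: measurable_below.
by rewrite lebesgue_measure_itv/=; case: ifP => _; rewrite ?ltry// -EFinB ltry.
Qed.

Lemma staircase_ge0 b x : 0 <= staircase b x.
Proof. exact: fine_ge0. Qed.

Lemma staircase_le0 b x : x <= 0 -> staircase b x = 0.
Proof.
move=> x0; rewrite /staircase (_ : _ `&` _ = set0) ?measure0//.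
by rewrite set_itv_ge ?setI0// -leNgt.
Qed.

Lemma le_staircase b x y : x <= y -> staircase b x <= staircase b y.
Proof.
move=> xy; apply: fine_le => //; apply: le_measure; rewrite ?inE; [exact: measurable_below..|].
by apply: setIS => z /=; rewrite !in_itv/= => /andP[-> /le_trans]; apply.
Qed.

Lemma staircase_lipschitz b x y : x <= y -> staircase b y - staircase b x <= y - x.
Proof.
move=> xy; rewrite lerBlDl -lee_fin EFinD !fineK//.
have -> : (y - x)%:E = lebesgue_measure `]x, y]%classic.
  rewrite lebesgue_measure_itv/= lte_fin; case: ltP => //.
  by move=> yx; have -> : x = y; [apply: le_anti; rewrite xy|rewrite subrr].
apply: le_trans (measureU2 _ _ _) => //; last exact: measurable_below.
apply: le_measure; rewrite ?inE; first exact: measurable_below.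
  by apply: measurableU => //; exact: measurable_below.
move=> z [hz] /=; rewrite !in_itv/= => /andP[z0 zy].
by have [zx|zx] := leP z x; [left; rewrite z0|right; rewrite zy].
Qed.

Lemma continuous_staircase b : continuous (@staircase R b).
Proof.
have L x y : `|staircase b x - staircase b y| <= `|x - y|.
  wlog xy : x y / x <= y => [H|].
    have [|/ltW] := leP x y; first exact: H.
    by move=> /H; rewrite distrC [X in _ <= X]distrC.
  rewrite distrC [X in _ <= X]distrC !ger0_norm ?subr_ge0 ?le_staircase//.
  exact: staircase_lipschitz.
move=> x; apply/cvgrPdist_le => e e0; near=> y.
apply: le_trans (L _ _) _; near: y.
by apply: cvgr_dist_le.
Unshelve. all: by end_near. Qed.

(** The arguments bound [dyadic_half_open k], an interval that [rises (odd k)] omits. *)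
Lemma staircase_flat k :
  staircase (odd k) (2^-1 ^+ k.+1) = staircase (odd k) (2^-1 ^+ k) :> R.
Proof.
congr (fine (lebesgue_measure _)).
have h0 : 0 <= 2^-1 :> R by [].
have h1 : 2^-1 <= 1 :> R by rewrite invf_le1// ler1n.
apply/seteqP; split => x [] [j /= jk jx]; rewrite !in_itv/= => /andP[x0 xk].
  by split; [exists j|rewrite x0 (le_trans xk)// ler_wiXn2l].
split; first by exists j.
have := jx; rewrite /dyadic_half_open /= !in_itv/= => /andP[xj1 xj2].
rewrite x0/= leNgt; apply/negP => xk1.
have [kj|jk'|e] := ltngtP k j; last by rewrite e eqxx in jk.
- by have := lt_le_trans xk1 (le_trans xj2 (ler_wiXn2l h0 h1 kj)); rewrite ltxx.
- by have := lt_le_trans xj1 (le_trans xk (ler_wiXn2l h0 h1 jk')); rewrite ltxx.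
Qed.

(** Of the two dyadic intervals just below 2^-k one is rising, and the shorter has length
    2^-(k+2). *)
Lemma staircase_ge b k : 2^-1 ^+ k.+2 <= staircase b (2^-1 ^+ k) :> R.
Proof.
have h0 : 0 <= 2^-1 :> R by [].
have h1 : 2^-1 <= 1 :> R by rewrite invf_le1// ler1n.
have step j : odd j != b -> (2^-1 ^+ j.+1 : R) <= staircase b (2^-1 ^+ j).
  move=> jb; rewrite -lee_fin fineK//.
  have -> : (2^-1 ^+ j.+1 : R)%:E = lebesgue_measure (@dyadic_half_open R j).
    have hj : 2^-1 ^+ j.+1 < 2^-1 ^+ j :> R.
      by rewrite exprS gtr_pMl ?exprn_gt0// invf_lt1// ltr1n.
    rewrite lebesgue_measure_itv/= lte_fin hj -EFinB exprS; congr EFin.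
    lra.
  apply: le_measure; rewrite ?inE.
  - exact: measurable_itv.
  - exact: measurable_below.
  - move=> x xj; split; first by exists j.
    move: xj; rewrite /dyadic_half_open /= !in_itv/= => /andP[jx ->].
    by rewrite (lt_trans _ jx)// exprn_gt0.
have [kb|kb] := boolP (odd k != b).
  by apply: le_trans (step _ kb); rewrite ler_wiXn2l.
apply: le_trans (step k.+1 _) (le_staircase _ _ _ _).
  by move: kb => /negPn/eqP <- /=; case: (odd k).
by rewrite ler_wiXn2l.
Qed.

End staircase.

(* The fourth root makes the arms of the cross much longer than the standard deviation
   [Num.sqrt t] of the Gaussian noise, for small t. *)
Definition arm_length {R : realType} (t : R) (b : bool) : R :=
  staircase b (Num.sqrt (Num.sqrt t)).

Lemma arm_length_ge0 {R : realType} (t : R) b : 0 <= arm_length t b.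
Proof. exact: staircase_ge0. Qed.

Lemma arm_length0 {R : realType} b : arm_length (0 : R) b = 0.
Proof. by rewrite /arm_length !sqrtr0 staircase_le0. Qed.

Lemma le_arm_length {R : realType} (s t : R) b : s <= t -> arm_length s b <= arm_length t b.
Proof. by move=> st; rewrite le_staircase// !ler_wsqrtr. Qed.

Lemma continuous_arm_length {R : realType} b : continuous (fun t : R => arm_length t b).
Proof.
move=> t; apply: (@continuous_comp _ _ _ (fun t : R => Num.sqrt (Num.sqrt t)) (staircase b)).
  by apply: continuous_comp; exact: sqrt_continuous.
exact: continuous_staircase.
Qed.

(** * The flow of cross laws is a weakly continuous square-integrable peacock *)

Definition arm {R : realType} (b : bool) : 'rV[R]_4 := delta_mx 0 (axis b).

Lemma crossE {R : realType} (s : bool -> R) i :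
  cross s i = ((vertex false i)%:~R * s false) *: arm false +
              ((vertex true i)%:~R * s true) *: arm true.
Proof.
apply/rowP => j; rewrite !mxE eqxx /=.
case: j => -[|[|[|[|//]]]] j /=;
  by rewrite ?mulr1 ?mulr0 ?addr0 ?add0r.
Qed.

(** Each inner point is a convex combination of the two outer ones, with weights [l] and [1 - l]
    where (2l - 1) b = a; the two convexity inequalities are added. *)
Lemma convex_even_homo {R : realType} {n} (f : 'rV[R]_n -> R) (v w : 'rV[R]_n) (a b : R) :
  convex_function [set: convex_lmodType 'rV[R]_n] f -> 0 <= a <= b ->
  f (w + a *: v) + f (w - a *: v) <= f (w + b *: v) + f (w - b *: v).
Proof.
move=> cf /andP[a0 ab]; have [b0|b0] := eqVneq b 0.
  by have -> : a = b by apply: le_anti; rewrite ab b0.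
have bp : 0 < b by rewrite lt_neqAle eq_sym b0 (le_trans a0).
pose l := (1 + a / b) / 2.
have l0 : 0 <= l by rewrite /l divr_ge0// addr_ge0// divr_ge0// ltW.
have l1 : l <= 1.
  by rewrite /l ler_pdivrMr// mul1r -lerBrDl (_ : 2 - 1 = 1) ?ler_pdivrMr ?mul1r//; lra.
have conv_at (k : R) (k0 : 0 <= k) (k1 : k <= 1) :
    f (w + ((2 * k - 1) * b) *: v) <= k * f (w + b *: v) + (1 - k) * f (w - b *: v).
  have := cf (Itv01 k0 k1) (w + b *: v) (w - b *: v); rewrite !inE => /(_ I I).
  apply: le_trans; rewrite le_eqVlt; apply/orP; left; apply/eqP; congr f.
  have -> : conv (Itv01 k0 k1) (w + b *: v : convex_lmodType 'rV[R]_n) (w - b *: v) =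
      k *: (w + b *: v) + (1 - k) *: (w - b *: v) by [].
  apply/rowP => j; rewrite !mxE; ring.
have e : (2 * l - 1) * b = a by rewrite /l; field.
have := conv_at l l0 l1; rewrite e.
have := conv_at (1 - l) _ _; rewrite subr_ge0 gerBl => /(_ l1 l0).
have -> : (2 * (1 - l) - 1) * b = - a by rewrite -e; ring.
rewrite scaleNr; set A := f _; set B := f (w + b *: v); set C := f (w - b *: v).
by move=> h1 h2; lra.
Qed.

Definition cross_flow {R : realType} (t : R) : probability 'rV[R]_4 R :=
  cross_law (arm_length t).

Lemma integral_cross_law {R : realType} (s : bool -> R) (f : 'rV[R]_4 -> R) :
  (\int[cross_law s]_x (f x)%:E = (5^-1 * \sum_(i < 5) f (cross s i))%:E)%E.
Proof. by rewrite integral_atoms//; exact: rV_measurable_set1. Qed.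

Lemma sum_cross {R : realType} (f : 'rV[R]_4 -> R) (s : bool -> R) :
  let v := s false *: arm false in let w := s true *: arm true in
  \sum_(i < 5) f (cross s i) = f 0 + (f (v + w) + (f (v - w) + (f (- v + w) + f (- v - w)))).
Proof.
move=> v w.
have E i : cross s i = (vertex false i)%:~R *: v + (vertex true i)%:~R *: w.
  by rewrite crossE !scalerA.
do 5 rewrite big_ord_recl; rewrite big_ord0 addr0 !E.
congr (f _ + (f _ + (f _ + (f _ + f _)))).
- by rewrite /vertex !scale0r addr0.
- by rewrite /vertex !scale1r.
- by rewrite /vertex scale1r scaleN1r.
- by rewrite /vertex scale1r scaleN1r.
- by rewrite /vertex !scaleN1r.
Qed.

(** The rectangle is enlarged one side at a time: first [a] to [a'] with [b] fixed, then [b] to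
    [b']. *)
Lemma convex_even2_homo {R : realType} {n} (f : 'rV[R]_n -> R) (v w : 'rV[R]_n)
    (a a' b b' : R) :
  convex_function [set: convex_lmodType 'rV[R]_n] f -> 0 <= a <= a' -> 0 <= b <= b' ->
  f (a *: v + b *: w) + (f (a *: v - b *: w) +
    (f (- (a *: v) + b *: w) + f (- (a *: v) - b *: w))) <=
  f (a' *: v + b' *: w) + (f (a' *: v - b' *: w) +
    (f (- (a' *: v) + b' *: w) + f (- (a' *: v) - b' *: w))).
Proof.
move=> cf aa bb.
have h1 := convex_even_homo f v (b *: w) _ _ cf aa.
have h2 := convex_even_homo f v (- (b *: w)) _ _ cf aa.
have h3 := convex_even_homo f w (a' *: v) _ _ cf bb.
have h4 := convex_even_homo f w (- (a' *: v)) _ _ cf bb.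
have sum4 (x1 x2 x3 x4 m1 m2 m3 m4 y1 y2 y3 y4 : R) :
    x1 + x3 <= m1 + m3 -> x2 + x4 <= m2 + m4 -> m1 + m2 <= y1 + y2 -> m3 + m4 <= y3 + y4 ->
    x1 + (x2 + (x3 + x4)) <= y1 + (y2 + (y3 + y4)) by lra.
move: h1 h2.
rewrite (addrC (b *: w) (a *: v)) (addrC (b *: w) (- (a *: v))).
rewrite (addrC (b *: w) (a' *: v)) (addrC (b *: w) (- (a' *: v))).
rewrite (addrC (- (b *: w)) (a *: v)) (addrC (- (b *: w)) (- (a *: v))).
rewrite (addrC (- (b *: w)) (a' *: v)) (addrC (- (b *: w)) (- (a' *: v))).
by move=> h1 h2; exact: sum4 h1 h2 h3 h4.
Qed.

Lemma peacock_cross_flow {R : realType} : peacock (@cross_flow R).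
Proof.
move=> s t /andP[s0 st] f cf; rewrite /cross_flow.
rewrite [leLHS]integral_cross_law [leRHS]integral_cross_law lee_fin.
apply: ler_wpM2l; first by rewrite invr_ge0.
rewrite (sum_cross f (arm_length s)) (sum_cross f (arm_length t)) lerD2l.
by apply: convex_even2_homo; rewrite // arm_length_ge0 le_arm_length.
Qed.

Lemma square_integrable_cross_flow {R : realType} : square_integrable (@cross_flow R).
Proof. by move=> t _; rewrite integral_cross_law ltry. Qed.

Lemma continuous_cross_arm_length {R : realType} i :
  continuous (fun t : R => cross (arm_length t) i).
Proof.
rewrite (_ : (fun t => _) = (fun t : R =>
  ((vertex false i)%:~R * arm_length t false) *: arm false +
  ((vertex true i)%:~R * arm_length t true) *: arm true)); last first.
  by apply/funext => t; rewrite crossE.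
by move=> t; apply: cvgD; apply: cvgZr_tmp; apply: cvgM;
  [exact: cvg_cst|exact: continuous_arm_length
  |exact: cvg_cst|exact: continuous_arm_length].
Qed.

Lemma weakly_continuous_cross_flow {R : realType} : weakly_continuous (@cross_flow R).
Proof.
move=> f cf _; apply: continuous_subspaceT => t.
have -> : (fun t => \int[cross_flow t]_x f x) =
    (fun t => 5^-1 * \sum_(i < 5) f (cross (arm_length t) i)).
  by apply/funext => u; rewrite /Rintegral integral_cross_law.
apply: cvgM; first exact: cvg_cst.
apply: cvg_big => [|i _]; first exact: add_continuous.
apply: (@continuous_comp _ _ _ (fun t => cross (arm_length t) i) f); last exact: cf.
exact: continuous_cross_arm_length.
Qed.

(** * Trivial events and conditioning on them *)

Section zero_one.
Context {R : realType} {d} {T : measurableType d} (P : probability T R).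

(** As the initial value of the process is almost surely 0, its completed sigma-algebra will consist
    of such events. *)
Definition zero_one : set_system T :=
  [set A | measurable A /\ (P A = 0%E \/ P A = 1%E)].

Lemma sigma_algebra_zero_one : sigma_algebra [set: T] zero_one.
Proof.
split.
- by split; [exact: measurable0|left; exact: measure0].
- move=> A [mA PA]; rewrite setTD; split; first exact: measurableC.
  rewrite probability_setC//.
  by case: PA => ->; [right; rewrite sube0|left; rewrite subee].
- move=> F FZ; have mF n : measurable (F n) by case: (FZ n).
  have mU : measurable (\bigcup_n F n) by exact: bigcupT_measurable.
  split => //; have [[n Fn1]|F0] := pselect (exists n, P (F n) = 1%E).
    right; apply/eqP; rewrite eq_le probability_le1//= -Fn1.
    by apply: le_measure; rewrite ?inE//; exact: bigcup_sup.
  left; apply/eqP; rewrite -measure_le0.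
  apply: le_trans (measure_sigma_subadditive _ mF mU _) _ => //.
  rewrite eseries0// => n _ _; case: (FZ n) => _ [//|Fn1].
  by case: F0; exists n.
Qed.

Lemma sigma_completed_zero_one (G : set_system T) :
  G `<=` zero_one -> sigma_completed P G `<=` zero_one.
Proof.
move=> GZ; apply: smallest_sub; first exact: sigma_algebra_zero_one.
by move=> A [/GZ//|[mA PA]]; split => //; left.
Qed.

(** As [G0] is trivial, the event that [Z] exceeds P(E) + e has probability 0 or 1, and 1 would make
    the mean of [Z] exceed P(E). Integrating [Z] over [A] gives the bound. The slack [e] replaces a
    proof that [Z] is almost surely constant. *)
Lemma conditional_prob_le (F0 G0 : set_system T) (E A : set T) (Z : T -> R) (e : R) :
  measurable E -> measurable A -> F0 A -> G0 `<=` zero_one -> 0 < e ->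
  is_cond_exp P F0 \1_E Z -> is_cond_exp P G0 \1_E Z ->
  (P (A `&` E) <= (fine (P E) + e)%:E * P A)%E.
Proof.
move=> mE mA FA GZ e0 [_ iZ _ condF] [_ _ ZG condG].
set c := fine (P E).
have PE : P E = c%:E by rewrite fineK// fin_num_measure.
have mZ : measurable_fun [set: T] Z by apply/measurable_EFinP; exact: (measurable_int P).
pose H := [set w | c + e < Z w].
have mH : measurable H.
  by rewrite -[H]setTI; exact: (measurable_fun_ltr (f := cst (c + e)) _ mZ).
have GH : G0 H.
  apply: ZG; exists `]c + e, +oo[%classic; first exact: measurable_itv.
  by rewrite setTI; apply/seteqP; split => w; rewrite /H /= in_itv/= andbT.
have intE B : measurable B -> (\int[P]_(w in B) (\1_E w)%:E = P (B `&` E))%E.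
  by move=> mB; rewrite integral_indic// setIC.
have PH : P H = 0%E.
  case: (GZ _ GH) => _ [//|PH1].
  have : ((c + e)%:E <= P (H `&` E))%E.
    rewrite -intE// -condG//.
    apply: (@le_trans _ _ (\int[P]_(w in H) (c + e)%:E)%E).
      by rewrite integral_cst// [leRHS](_ : _ = (c + e)%:E)// -[RHS]mule1 -PH1.
    apply: le_integral => //; first exact: finite_measure_integrable_cst.
      exact: integrableS iZ.
    by move=> w; rewrite inE /H /= lee_fin => /ltW.
  move=> /le_trans -/(_ (P E)); rewrite PE lee_fin => h.
  have : c + e <= c.
    by apply: h; rewrite -PE; apply: le_measure; rewrite ?inE//; exact: measurableI.
  by rewrite gerDl leNgt e0.
rewrite -intE// -condF// (negligible_integral _ _ _ PH)//; last exact: integrableS iZ.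
apply: (@le_trans _ _ (\int[P]_(w in A `\` H) (c + e)%:E)%E).
  apply: le_integral => //.
  - exact: measurableD.
  - by apply: integrableS iZ => //; exact: measurableD.
  - by apply: finite_measure_integrable_cst; exact: measurableD.
  - by move=> w; rewrite inE => -[_] /negP; rewrite -leNgt lee_fin.
rewrite integral_cst//; last exact: measurableD.
apply: lee_wpmul2l; first by rewrite lee_fin addr_ge0 ?fine_ge0// ltW.
by apply: le_measure; rewrite ?inE//; exact: measurableD.
Qed.

End zero_one.

Lemma gaussian4_0 {R : realType} (B : set 'rV[R]_4) : gaussian4 0 B = \d_(0 : 'rV[R]_4) B.
Proof. by rewrite /gaussian4 ltxx. Qed.

Lemma law_at_zero {R : realType} (s : bool -> R) (B : set 'rV[R]_4) :
  (forall b, s b = 0) ->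
  convolution (cross_law s) (gaussian4 0) B = \d_(0 : 'rV[R]_4) B.
Proof.
move=> s0; rewrite convolution_cross.
rewrite (eq_bigr (fun=> \d_(0 : 'rV[R]_4) B)); last first.
  move=> i _; rewrite gaussian4_0 !diracE; congr (nat_of_bool _)%:R%:E.
  have -> : cross s i = 0 by apply/rowP => j; rewrite !mxE s0 mulr0 if_same.
  by under eq_set do rewrite add0r.
rewrite !diracE sumEFin -EFinM sumr_const card_ord; congr EFin.
by set b := _%:R; field.
Qed.

(** * Events that hold from some index on *)

(** The lower limit of the sequence of events. *)
Definition eventually {T : Type} (E : nat -> set T) : set T :=
  \bigcup_n \bigcap_k E (n + k)%N.

(** Dropping finitely many events is what places the lower limit in the germ field. *)
Lemma eventually_shift {T : Type} (E : nat -> set T) m :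
  eventually (fun k => E (m + k)%N) = eventually E.
Proof.
apply/seteqP; split => w [n _ Ew].
  by exists (m + n)%N => // k _; rewrite -addnA; exact: Ew.
by exists n => // k _; rewrite addnCA; exact: Ew.
Qed.

Lemma sigma_algebra_eventually {T : Type} (G : set_system T) (E : nat -> set T) :
  sigma_algebra [set: T] G -> (forall k, G (E k)) -> G (eventually E).
Proof.
move=> [_ GC GU] GE; apply: (GU) => n.
rewrite -[\bigcap_k _]setCK setC_bigcap -setTD; apply: (GC); apply: (GU) => k.
by rewrite -setTD; apply: (GC).
Qed.

Section eventually_prob.
Context {R : realType} {d} {T : measurableType d} (P : probability T R).
Context (E : nat -> set T) (mE : forall k, measurable (E k)).

Lemma measurable_eventually : measurable (eventually E).
Proof. by apply: bigcupT_measurable => n; exact: bigcapT_measurable. Qed.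

(** The intersections of the tails increase to the lower limit, and each is contained in its first
    event. *)
Lemma eventually_prob_le (m : nat) (p : \bar R) :
  (forall k, (m <= k)%N -> (P (E k) <= p)%E) -> (P (eventually E) <= p)%E.
Proof.
move=> Ep; have mD n : measurable (\bigcap_k E (n + k)%N) by exact: bigcapT_measurable.
have cv : P (\bigcap_k E (n + k)%N) @[n --> \oo] --> P (eventually E).
  apply: (nondecreasing_cvg_mu (F := fun n => \bigcap_k E (n + k)%N)) => //.
    exact: measurable_eventually.
  move=> i j ij; apply/subsetPset => w Ew k _.
  by have := Ew (j - i + k)%N I; rewrite addnA subnKC.
rewrite -(cvg_lim _ cv)//; apply: lime_le; first by apply/cvg_ex; exists (P (eventually E)).
exists m => // n /= mn; apply: le_trans (Ep _ mn).
apply: le_measure; rewrite ?inE//.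
by move=> w /(_ 0%N I); rewrite addn0.
Qed.

(** On [E n], either all later events hold or some escape from [E k] to the complement of [E k.+1]
    occurs with [n <= k]; the escape bounds form a geometric series. *)
Lemma prob_le_eventually (n : nat) (a : R) : 0 <= a ->
  (forall k, P (E k `\` E k.+1) <= (a * 2^-1 ^+ k)%:E)%E ->
  (P (E n) <= P (eventually E `&` E n) + (2 * a * 2^-1 ^+ n)%:E)%E.
Proof.
move=> a0 Ea.
pose D k := E (n + k)%N `\` E (n + k).+1.
have mD k : measurable (D k) by exact: measurableD.
have mU : measurable (\bigcup_k D k) by exact: bigcupT_measurable.
have sub : E n `<=` (eventually E `&` E n) `|` \bigcup_k D k.
  move=> w En; have [Dw|nD] := pselect ((\bigcup_k D k) w); first by right.
  left; split => //; exists n => // k _; elim: k => [|k IH]; first by rewrite addn0.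
  by apply: contrapT => nE; apply: nD; exists k => //; split => //; rewrite -addnS.
have mL : measurable (eventually E `&` E n).
  by apply: measurableI => //; exact: measurable_eventually.
apply: (@le_trans _ _ (P ((eventually E `&` E n) `|` \bigcup_k D k))).
  by apply: le_measure; rewrite ?inE//; exact: measurableU.
apply: le_trans (measureU2 _ mL mU) _; apply: leeD => //.
apply: le_trans (measure_sigma_subadditive _ mD mU (@subset_refl _ _)) _.
have geo m : \sum_(0 <= k < m) a * 2^-1 ^+ (n + k) = 2 * a * 2^-1 ^+ n * (1 - 2^-1 ^+ m).
  elim: m => [|j IH]; first by rewrite big_nil expr0 subrr mulr0.
  by rewrite big_nat_recr//= IH exprS exprD; field.
apply: lime_le; first exact: is_cvg_nneseries.
near=> m.
apply: (@le_trans _ _ (\sum_(0 <= k < m) (a * 2^-1 ^+ (n + k))%:E)%E).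
  by apply: lee_sum => k _; exact: Ea.
by rewrite sumEFin lee_fin geo ler_piMr ?mulr_ge0 ?exprn_ge0//.
Unshelve. all: by end_near. Qed.

End eventually_prob.

(** * Dyadic times and the ratio of noise to arm length *)

(** This is 16^-k, written so that its fourth root is the breakpoint 2^-k of the staircases. *)
Definition dyadic_time {R : realType} (k : nat) : R := (2^-1 ^+ k) ^+ 4.

Lemma sqrt_dyadic_time {R : realType} k :
  Num.sqrt (dyadic_time k) = (2^-1 ^+ k) ^+ 2 :> R.
Proof.
rewrite /dyadic_time (_ : _ ^+ 4 = ((2^-1 ^+ k) ^+ 2) ^+ 2) ?sqrtr_sqr -?exprM//.
by rewrite ger0_norm// exprn_ge0.
Qed.

Lemma arm_length_dyadic {R : realType} k b :
  arm_length (dyadic_time k : R) b = staircase b (2^-1 ^+ k).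
Proof. by rewrite /arm_length sqrt_dyadic_time sqrtr_sqr ger0_norm. Qed.

Lemma dyadic_time_gt0 {R : realType} k : 0 < dyadic_time k :> R.
Proof. by rewrite !exprn_gt0. Qed.

Lemma dyadic_time_leS {R : realType} k : dyadic_time k.+1 <= dyadic_time k :> R.
Proof.
rewrite /dyadic_time lerXn2r ?nnegrE ?exprn_ge0// exprS ler_piMl ?exprn_ge0//.
by rewrite invf_le1// ler1n.
Qed.

Lemma arm_length_dyadic_gt0 {R : realType} k b : 0 < arm_length (dyadic_time k : R) b.
Proof. by rewrite arm_length_dyadic (lt_le_trans _ (staircase_ge _ _))// exprn_gt0. Qed.

(** The standard deviation is 4^-k and the arm is at least 2^-(k+2), whence the factor 4. *)
Lemma noise_ratio {R : realType} k b :
  Num.sqrt (dyadic_time k) / arm_length (dyadic_time k : R) b <= 4 * 2^-1 ^+ k.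
Proof.
rewrite ler_pdivrMr ?arm_length_dyadic_gt0// sqrt_dyadic_time arm_length_dyadic.
have h := staircase_ge b k (R := R); rewrite !exprS in h.
have h0 : 0 <= 2^-1 ^+ k :> R by rewrite exprn_ge0.
have := ler_wpM2l h0 h; rewrite expr2; lra.
Qed.

Lemma dyadic_time_small {R : realType} (u : R) : 0 < u ->
  exists m, forall k, dyadic_time (m + k) <= u.
Proof.
move=> u0; have : (fun k => 2^-1 ^+ k) @ \oo --> (0 : R).
  by apply: cvg_expr; rewrite ger0_norm// invf_lt1// ltr1n.
move=> /cvgr0Pnorm_le /(_ _ u0) [m _ hm]; exists m => k.
have := hm (m + k)%N (leq_addr _ _); rewrite ger0_norm ?exprn_ge0//; apply: le_trans.
rewrite /dyadic_time exprSr ler_piMl ?exprn_ge0// exprn_ile1 ?exprn_ge0//.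
by rewrite exprn_ile1// invf_le1// ler1n.
Qed.

(** * The contradiction at time 0 *)

Section no_markov_martingale.
Context {R : realType} {d} {T : measurableType d} (P : probability T R).
Context (Y : R -> {RV P >-> 'rV[R]_4}).
Context (lawY : forall t : R, 0 <= t -> forall B : set 'rV[R]_4, measurable B ->
  distribution P (Y t) B = convolution (cross_flow t) (gaussian4 t) B).

Let near_origin (k : nat) (b : bool) : set 'rV[R]_4 :=
  [set y | `|y ord0 (axis b)| < arm_length (dyadic_time k) b / 2].

Let measurable_near_origin k b : measurable (near_origin k b).
Proof.
have m : measurable_fun [set: R] (@Num.norm R R) by exact: normr_measurable.
apply: (measurable_axis b [set x | `|x| < arm_length (dyadic_time k) b / 2]).
rewrite -[X in measurable X]setTI.
exact: (measurable_fun_ltr (g := cst (arm_length (dyadic_time k) b / 2)) m _).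
Qed.

(** The axis tested is the one whose arm has equal lengths at the dyadic times [k] and [k.+1]. *)
Let at_center (k : nat) : set T :=
  Y (dyadic_time k) @^-1` near_origin k (odd k).

Let measurable_preim k b v : measurable (Y v @^-1` near_origin k b).
Proof. exact: measurable_funPTI. Qed.

Let law k (B : set 'rV[R]_4) : measurable B ->
  distribution P (Y (dyadic_time k)) B =
  convolution (cross_law (arm_length (dyadic_time k))) (gaussian4 (dyadic_time k)) B.
Proof. by move=> mB; apply: lawY => //; rewrite ltW// dyadic_time_gt0. Qed.

Let t0 k : 0 < dyadic_time k :> R := dyadic_time_gt0 k.
Let s0 k b : 0 < arm_length (dyadic_time k : R) b := arm_length_dyadic_gt0 k b.

Lemma at_center_le k : (P (at_center k) <= (5^-1 + 16 * 2^-1 ^+ k)%:E)%E.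
Proof.
apply: le_trans (mode_prob_le P _ _ _ (t0 k) (s0 k) (law k) (odd k)) _.
by rewrite lee_fin; have := noise_ratio (R := R) k (odd k); lra.
Qed.

Lemma at_center_ge k : ((5^-1 - 16 * 2^-1 ^+ k)%:E <= P (at_center k))%E.
Proof.
apply: le_trans (mode_prob_ge P _ _ _ (t0 k) (s0 k) (law k) (odd k)).
by rewrite lee_fin; have := noise_ratio (R := R) k (odd k); lra.
Qed.

(** Going back from [t] to [u], the mode persists along the axis [c]; then, at time [u], the test
    passes from [c] to the other axis. By [noise_ratio] the two stages cost 64 and 16 times 2^-k. *)
Lemma at_center_escape (F : R -> set_system T) k : is_martingale P F Y ->
  (P (at_center k `\` at_center k.+1) <= (80 * 2^-1 ^+ k)%:E)%E.
Proof.
move=> mart; pose c := odd k; pose t : R := dyadic_time k; pose u : R := dyadic_time k.+1.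
have sE : arm_length u c = arm_length t c.
  by rewrite !arm_length_dyadic staircase_flat.
have H1 := mode_persistence P F Y mart u t (arm_length u) (arm_length t) c
  (t0 _) (dyadic_time_leS _) (s0 _) sE (law _) (law _).
have H2 := mode_disagreement P (Y u) (arm_length u) u (t0 _) (s0 _) (law _) c (~~ c).
have E1 : Y t @^-1` near_origin k c `\` Y u @^-1` near_origin k.+1 c =
   [set w | `|Y t w ord0 (axis c)| < arm_length t c / 2 /\
            arm_length t c / 2 <= `|Y u w ord0 (axis c)| ].
  rewrite -sE; apply/seteqP; split => w /= []; rewrite /near_origin /= -/t -/u.
    by rewrite sE => -> /negP; rewrite -leNgt.
  by rewrite sE => -> h; split => //; apply/negP; rewrite -leNgt.
have E2 : Y u @^-1` near_origin k.+1 c `\` at_center k.+1 =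
   [set w | `|Y u w ord0 (axis c)| < arm_length u c / 2 /\
            arm_length u (~~ c) / 2 <= `|Y u w ord0 (axis (~~ c))| ].
  apply/seteqP; split => w /= []; rewrite /at_center /near_origin /= -/t -/u -/c => ->.
    by move=> /negP; rewrite -leNgt.
  by move=> h; split => //; apply/negP; rewrite -leNgt.
rewrite -E1 in H1; rewrite -E2 in H2.
apply: (@le_trans _ _ (P ((Y t @^-1` near_origin k c `\` Y u @^-1` near_origin k.+1 c) `|`
    (Y u @^-1` near_origin k.+1 c `\` at_center k.+1)))).
  apply: le_measure; rewrite ?inE.
  - by apply: measurableD; exact: measurable_preim.
  - by apply: measurableU; apply: measurableD; exact: measurable_preim.
  - move=> w [h1 h2]; have [h|h] := pselect ((Y u @^-1` near_origin k.+1 c) w).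
      by right.
    by left.
apply: le_trans (measureU2 _ _ _) _.
- by apply: measurableD; exact: measurable_preim.
- by apply: measurableD; exact: measurable_preim.
apply: le_trans (leeD H1 H2) _; rewrite -EFinD lee_fin.
have n1 := noise_ratio (R := R) k c.
have n2 := noise_ratio (R := R) k.+1 c; have n3 := noise_ratio (R := R) k.+1 (~~ c).
rewrite !exprS -/t -/u in n1 n2 n3; lra.
Qed.

Lemma at_center_filtration k u : dyadic_time k <= u ->
  sigma_completed P (natural_filtration Y u) (at_center k).
Proof.
move=> ku; apply: sub_sigma_algebra; left; apply: sub_sigma_algebra.
exists (dyadic_time k); first by rewrite /= in_itv/= ku ltW// dyadic_time_gt0.
by exists (near_origin k (odd k)) => //; rewrite setTI.
Qed.

(** For each [u > 0] all but finitely many dyadic times are at most [u]. *)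
Lemma eventually_at_center_germ : usual_filtration P Y 0 (eventually at_center).
Proof.
move=> u /=; rewrite in_itv/= andbT => u0.
have [m mu] := dyadic_time_small u u0.
rewrite -(eventually_shift _ m); apply: sigma_algebra_eventually.
  exact: smallest_sigma_algebra.
by move=> k; apply: at_center_filtration.
Qed.

Lemma initial_zero_one : g_sigma_algebra_preimage (Y 0) `<=` zero_one P.
Proof.
move=> _ [B mB <-]; rewrite setTI; split; first exact: measurable_funPTI.
have := lawY 0 (lexx _) B mB; rewrite law_at_zero; last exact: arm_length0.
rewrite /distribution /pushforward => ->; rewrite diracE.
by case: (_ \in _); [right|left].
Qed.

Lemma not_markov_martingale : is_martingale P (usual_filtration P Y) Y ->
  ~ is_markov P (usual_filtration P Y) Y.
Proof.
(* For [n = 14] the errors 16/2^n and 160/2^n are below 1/100. With E the event [at_center n], P(E)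
   is then nearly at least 1/5 and A holds on nearly all of E, whereas the Markov property bounds
   the probability of both by (P(E) + 1/10) 2/5. *)
move=> mart markov; pose n := 14%N; pose A := eventually at_center.
have mC k : measurable (at_center k) by exact: measurable_preim.
have mA : measurable A by exact: measurable_eventually.
have h : 2^-1 ^+ n = 128^-1 * 128^-1 :> R.
  by rewrite /n; field.
have step k : (P (at_center k `\` at_center k.+1) <= (80 * 2^-1 ^+ k)%:E)%E.
  exact: at_center_escape mart.
have l1 := prob_le_eventually P at_center mC n 80 (ler0n _ _) step.
have l2 : (P A <= (2 / 5)%:E)%E.
  apply: (eventually_prob_le P at_center mC n) => k nk.
  apply: le_trans (at_center_le k) _; rewrite lee_fin.
  have : 2^-1 ^+ k <= 2^-1 ^+ n :> R by apply: ler_wiXn2l; rewrite // invf_le1// ler1n.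
  by rewrite h; lra.
have l3 := at_center_ge n.
(* The Markov property between time 0 and a dyadic time, for the indicator of being near the
   origin. *)
have [|||Z [ZF ZY]] := markov 0 (dyadic_time n) _ (\1_(near_origin n (odd n))).
- by rewrite lexx ltW// dyadic_time_gt0.
- exact: measurable_indic.
- by exists 1 => y; rewrite indicE; case: (_ \in _); rewrite /= ?normr1 ?normr0.
have fE : \1_(near_origin n (odd n)) \o Y (dyadic_time n) = \1_(at_center n) :> (T -> R).
  by apply/funext => w.
rewrite fE in ZF ZY.
have := conditional_prob_le P _ _ (at_center n) A Z 10^-1 (mC n) mA
  eventually_at_center_germ (sigma_completed_zero_one P _ initial_zero_one) _ ZF ZY.
rewrite invr_gt0 ltr0n => /(_ isT).
have fin (S : set T) : measurable S -> exists2 p : R, 0 <= p & P S = p%:E.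
  move=> mS; exists (fine (P S)); first exact: fine_ge0.
  by rewrite fineK// fin_num_measure.
move: l1 l2 l3; rewrite -/A.
have [pA pA0 ->] := fin A mA; have [pE pE0 ->] := fin _ (mC n).
have [pI pI0 ->] := fin _ (measurableI _ _ mA (mC n)).
rewrite h -EFinD -EFinM !lee_fin /= => l1 l2 l3 l4.
(* The only nonlinear term is bounded separately, which leaves a linear contradiction. *)
have : pE * pA <= pE * (2 / 5) by rewrite ler_wpM2l.
lra.
Qed.

End no_markov_martingale.

Theorem theorem1p4 (R : realType) :
  exists mu : R -> probability 'rV[R]_4 R,
    [/\ peacock mu, square_integrable mu, weakly_continuous mu &
      ~ exists (d : measure_display) (T : measurableType d)
            (P : probability T R) (Y : R -> {RV P >-> 'rV[R]_4}),
          [/\ forall t : R, 0 <= t -> forall B : set 'rV[R]_4, measurable B ->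
                distribution P (Y t) B = convolution (mu t) (gaussian4 t) B,
              is_martingale P (usual_filtration P Y) Y &
              is_markov P (usual_filtration P Y) Y]].
Proof.
exists cross_flow; split.
- exact: peacock_cross_flow.
- exact: square_integrable_cross_flow.
- exact: weakly_continuous_cross_flow.
- by move=> [d [T [P [Y [lawY mart]]]]]; exact: not_markov_martingale lawY mart.
Qed.
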